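(* Let $N$ be a finitely generated nilpotent group. Then either $N$ is virtually abelian or $N$ is not virtually RFRS.
   Context: A group $G$ is called residually finite rationally solvable, or RFRS, if there exists an exhaustive filtration (i.e. $\bigcap_i G_i=\{1\}$) of subgroups $G=G_0>G_1>G_2>\cdots$, each $G_i$ being normal in $G$ and of finite index in $G$, such that for every $i\ge 0$ one has $G_{i+1}>\ker\{G_i\to G_i^{ab}\otimes\mathbb{Q}\}$. Here $>$ denotes containment as a subgroup, $G_i^{ab}$ is the abelianization of $G_i$, and $G_i\to G_i^{ab}\otimes\mathbb{Q}$ is the natural map. A group virtually has a property (e.g. virtually RFRS, virtually abelian) if it has a finite index subgroup with that property. *)

(* Defs.v *)
From HB Require Import structures.
From mathcomp Require Import all_boot all_order all_algebra.
From mathcomp Require Import boolp classical_sets functions cardinality.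

Set Implicit Arguments.
Unset Strict Implicit.
Unset Printing Implicit Defensive.

Local Open Scope classical_set_scope.
Local Open Scope group_scope.

(* Groups may be infinite, so subgroups are classical sets.  The predicates
   below regard a subgroup H of the ambient group as a group in its own right;
   the ambient group itself is [set: G]. *)

Definition is_subgroup (G : groupType) (H : set G) : Prop :=
  [/\ H 1,
      forall x y, H x -> H y -> H (x * y) &
      forall x, H x -> H x^-1].

Definition gen (G : groupType) (S : set G) : set G := smallest (@is_subgroup G) S.

Definition commutator (G : groupType) (A B : set G) : set G :=
  gen [set z | exists x y, [/\ A x, B y & z = [~ x, y]]].

Definition coset (G : groupType) (K : set G) (x : G) : set G :=
  [set x * k | k in K].

Definition finite_index (G : groupType) (K H : set G) : Prop :=
  K `<=` H /\ finite_set [set coset K x | x in H].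

Definition normal_in (G : groupType) (K H : set G) : Prop :=
  K `<=` H /\ forall x k, H x -> K k -> K (k ^ x).

Definition abelian (G : groupType) (H : set G) : Prop :=
  forall x y, H x -> H y -> commute x y.

Definition finitely_generated (G : groupType) (H : set G) : Prop :=
  exists2 S : set G, finite_set S & gen S = H.

Definition lower_central (G : groupType) (H : set G) (n : nat) : set G :=
  iter n (fun A => commutator A H) H.

Definition nilpotent (G : groupType) (H : set G) : Prop :=
  exists n, lower_central H n = [set 1].

(* The natural map from H to its abelianization, whose elements are the cosets
   of [H, H] in H. *)
Definition ab (G : groupType) (H : set G) (x : G) : set G :=
  coset (commutator H H) x.

(* The tensor product of the abelianization of H with Q over Z, by generators
   and relations: the list [:: (a1, q1); ...; (an, qn)] stands for the sum of
   the ai (x) qi, and two lists are related when their sums agree.  Lists form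
   a monoid rather than a group, hence the explicit relation x (x) 0 = 0, which
   makes (x, - q) an inverse of (x, q). *)
Inductive tensor_eq (G : groupType) (H : set G) :
    seq (set G * rat) -> seq (set G * rat) -> Prop :=
| tensor_refl s : tensor_eq H s s
| tensor_sym s t : tensor_eq H s t -> tensor_eq H t s
| tensor_trans s t u : tensor_eq H s t -> tensor_eq H t u -> tensor_eq H s u
| tensor_cat s s' t t' :
    tensor_eq H s s' -> tensor_eq H t t' -> tensor_eq H (s ++ t) (s' ++ t')
| tensor_catC s t : tensor_eq H (s ++ t) (t ++ s)
| tensor_addl x y (q : rat) : H x -> H y ->
    tensor_eq H [:: (ab H x, q); (ab H y, q)] [:: (ab H (x * y), q)]
| tensor_addr x (q r : rat) : H x ->
    tensor_eq H [:: (ab H x, q); (ab H x, r)] [:: (ab H x, (q + r)%R)]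
| tensor_zero x : H x -> tensor_eq H [:: (ab H x, 0%R)] [::].

(* The kernel of the map from H sending x to ab x (x) 1. *)
Definition ker_abQ (G : groupType) (H : set G) : set G :=
  [set x | H x /\ tensor_eq H [:: (ab H x, 1%R)] [::]].

Definition RFRS (G : groupType) (H : set G) : Prop :=
  exists F : nat -> set G,
    [/\ F 0%N = H,
        forall i, is_subgroup (F i) /\ F i.+1 `<=` F i,
        forall i, normal_in (F i) H /\ finite_index (F i) H,
        \bigcap_i F i = [set 1] &
        forall i, ker_abQ (F i) `<=` F i.+1].

Definition virtually (G : groupType) (P : set G -> Prop) (H : set G) : Prop :=
  exists K : set G, [/\ is_subgroup K, finite_index K H & P K].

(* Main.v *)
Require Import Defs.
From HB Require Import structures.
From mathcomp Require Import all_boot all_order all_algebra.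
From mathcomp Require Import boolp classical_sets functions cardinality.

Local Open Scope classical_set_scope.

(** The dichotomy holds because an RFRS finite-index subgroup [H] of a nilpotent
group is itself abelian.

Suppose that [x], [y] lie in [H] and that [z = [~ x, y]] commutes with both.
Each term [F i] of an RFRS filtration has finite index, so it contains powers
[x ^+ n] and [y ^+ m] with [n, m > 0], and [F i] has the commutator
[[~ x ^+ n, y ^+ m] = z ^+ (n * m)].  Hence as soon as [z] is in [F i], its
class in the abelianization of [F i] is torsion, it dies after tensoring with
the rationals ([torsion_ker_abQ]), and [z] is in [F i.+1].  Thus [z] is in every
[F i], which forces [z = 1] ([RFRS_central_commg]).

Nilpotency provides such central commutators: descending along the lower
central series, if the elements of [H] in its term [k + 1] centralize [H], then
for [x] in [H] and in term [k] every [[~ x, y]] with [y] in [H] is in term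
[k + 1], so it commutes with [x] and [y] and is trivial; hence [x] centralizes
[H] too ([nilpotent_RFRS_abelian]). *)

Section Commutators.
Local Open Scope group_scope.
Context {G : groupType}.
Implicit Types x y : G.

Lemma commXg x y n : commute x [~ x, y] -> [~ x ^+ n, y] = [~ x, y] ^+ n.
Proof.
move=> cxz; have xyE : x ^ y = x * [~ x, y] by rewrite mulVKg.
by rewrite commgEl conjXg xyE expgMn // mulKg.
Qed.

Lemma commgX x y n : commute y [~ x, y] -> [~ x, y ^+ n] = [~ x, y] ^+ n.
Proof.
move=> cyz; rewrite -[LHS]invgK invgR commXg; last first.
  by rewrite -invgR; apply: commuteV.
by rewrite -invgR expVgn invgK.
Qed.

Lemma commXXg x y n m : commute x [~ x, y] -> commute y [~ x, y] ->
  [~ x ^+ n, y ^+ m] = [~ x, y] ^+ (n * m).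
Proof.
move=> cxz cyz; rewrite commgX commXg // ?expgnA //.
exact: commuteX.
Qed.

End Commutators.

Section Subgroups.
Local Open Scope group_scope.
Context {G : groupType}.
Implicit Types (x y : G) (A B H K : set G).

Lemma is_subgroup_gen A : is_subgroup (gen A).
Proof.
split=> [K [[]]//|x y Ax Ay K [sK AK]|x Ax K [sK AK]].
- by case: (sK) => _ KM _; apply: KM; [apply: Ax|apply: Ay].
- by case: (sK) => _ _; apply; apply: Ax.
Qed.

Lemma mem_commutator A B x y : A x -> B y -> commutator A B [~ x, y].
Proof. by move=> Ax By; apply: sub_gen_smallest; exists x, y. Qed.

Lemma subgroupX H x n : is_subgroup H -> H x -> H (x ^+ n).
Proof.
by move=> [H1 HM _] Hx; elim: n => [//|n IHn]; rewrite expgS; apply: HM.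
Qed.

Lemma subgroupR H x y : is_subgroup H -> H x -> H y -> H [~ x, y].
Proof.
move=> [_ HM HV] Hx Hy; rewrite /commg conjgE.
by apply: (HM); [apply: HV|apply: (HM); [apply: HV|apply: HM]].
Qed.

Lemma coset_id K x : is_subgroup K -> K x -> coset K x = coset K 1.
Proof.
move=> [_ KM KV] Kx; apply/seteqP; split=> _ [k Kk <-].
  by exists (x * k); [apply: KM|rewrite mul1g].
by exists (x^-1 * k); [apply: KM => //; apply: KV|rewrite mul1g mulVKg].
Qed.

(** Pigeonhole: the cosets of the powers [x ^+ n] cannot all be distinct, and the
quotient of two powers in the same coset is in [K]. *)
Lemma finite_index_expg K H x : is_subgroup H -> is_subgroup K ->
  finite_index K H -> H x -> exists n, K (x ^+ n.+1).
Proof.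
move=> sH [K1 _ _] [_ finKH] Hx; apply: contrapT => noK; apply: infinite_nat.
have inj n m : n < m -> coset K (x ^+ n) <> coset K (x ^+ m).
  move=> ltnm eqK; apply: noK; exists (m - n).-1.
  have : coset K (x ^+ m) (x ^+ m) by exists 1 => //; rewrite mulg1.
  rewrite -eqK prednK ?subn_gt0 // => -[k Kk].
  by rewrite -{1}(subnKC (ltnW ltnm)) expgnDr => /mulgI <-.
apply: sub_finite_set (finite_preimage (f := fun n => coset K (x ^+ n)) _ finKH).
  by move=> n _; exists (x ^+ n) => //; apply: subgroupX.
move=> n m _ _ eqK.
by case: (ltngtP n m) => [/inj|/inj|//] // /(_ (esym eqK)).
Qed.

End Subgroups.

Section RationalAbelianization.
Import GRing.Theory Num.Theory.
Local Open Scope ring_scope.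
Context {G : groupType} {H : set G}.
Implicit Types (x : G) (q : rat).

(** Already [1 * 1 = 1] makes the generator [1 (x) q] idempotent for addition,
and adding [1 (x) (- q)] cancels it. *)
Lemma tensor_one q : is_subgroup H -> tensor_eq H [:: (ab H 1%g, q)] [::].
Proof.
case=> H1 _ _; set a := (_, q).
have cancel : tensor_eq H [:: a; (ab H 1%g, - q)] [::].
  apply: tensor_trans (tensor_addr _ _ H1) _.
  by rewrite addrN; apply: tensor_zero.
have idem : tensor_eq H [:: a; a] [:: a].
  apply: tensor_trans (tensor_addl _ H1 H1) _.
  by rewrite mulg1; apply: tensor_refl.
apply: tensor_trans (cancel).
apply: tensor_trans (tensor_cat idem (tensor_refl H [:: (ab H 1%g, - q)])).
exact: tensor_cat (tensor_refl H [:: a]) (tensor_sym cancel).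
Qed.

Lemma tensor_nseq_expg x q n : is_subgroup H -> H x ->
  tensor_eq H (nseq n (ab H x, q)) [:: (ab H (x ^+ n)%g, q)].
Proof.
move=> sH Hx; elim: n => [|n IHn]; first exact/tensor_sym/tensor_one.
apply: tensor_trans (tensor_cat (tensor_refl H [:: (ab H x, q)]) IHn) _.
by rewrite expgS; apply: tensor_addl => //; apply: subgroupX.
Qed.

Lemma tensor_nseq_mulrn x q n : H x ->
  tensor_eq H (nseq n (ab H x, q)) [:: (ab H x, q *+ n)].
Proof.
move=> Hx; elim: n => [|n IHn]; first exact/tensor_sym/tensor_zero.
apply: tensor_trans (tensor_cat (tensor_refl H [:: (ab H x, q)]) IHn) _.
by rewrite mulrS; apply: tensor_addr.
Qed.

(** The tensor [x (x) 1] is a sum of [n.+1] copies of [x (x) (1 / n.+1)], so it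
equals [x ^+ n.+1 (x) (1 / n.+1)], and [x ^+ n.+1] is trivial in the
abelianization. *)
Lemma torsion_ker_abQ x n : is_subgroup H -> H x ->
  commutator H H (x ^+ n.+1)%g -> ker_abQ H x.
Proof.
move=> sH Hx Cx; split=> //.
have q1 : n.+1%:R^-1 *+ n.+1 = 1 :> rat.
  by rewrite -[LHS]mulr_natr mulVf ?pnatr_eq0.
rewrite -q1; apply: tensor_trans (tensor_sym (tensor_nseq_mulrn _ _ _ Hx)) _.
apply: tensor_trans (tensor_nseq_expg _ _ _ sH Hx) _.
rewrite /ab (coset_id _ _ (is_subgroup_gen _) Cx).
exact: tensor_one.
Qed.

End RationalAbelianization.

Section NilpotentRFRS.
Local Open Scope group_scope.
Context {G : groupType}.
Implicit Types (x y : G) (H : set G).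

(** By induction along the filtration: powers of [x] and [y] survive in each
term, so a power of [[~ x, y]] is a commutator there. *)
Lemma RFRS_central_commg H x y : RFRS H -> H x -> H y ->
  commute x [~ x, y] -> commute y [~ x, y] -> [~ x, y] = 1.
Proof.
case=> F [F0 sF nF Fcap kerF] Hx Hy cxz cyz.
have sH : is_subgroup H by rewrite -F0; case: (sF 0%N).
suff Fz i : F i [~ x, y].
  have : (\bigcap_i F i) [~ x, y] by move=> i _.
  by rewrite Fcap.
elim: i => [|i IHi]; first by rewrite F0; apply: subgroupR.
have [sFi _] := sF i; have [_ iFi] := nF i; apply: kerF.
have [n Fx] := finite_index_expg _ _ _ sH sFi iFi Hx.
have [m Fy] := finite_index_expg _ _ _ sH sFi iFi Hy.
apply: (torsion_ker_abQ _ (n.+1 * m.+1).-1) => //.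
by rewrite prednK // -commXXg //; apply: mem_commutator.
Qed.

(** Descending induction along the lower central series of the ambient group,
which captures the commutators of its elements with those of [H]. *)
Lemma nilpotent_RFRS_abelian H : Defs.nilpotent [set: G] ->
  is_subgroup H -> RFRS H -> Defs.abelian H.
Proof.
move=> [n gn1] sH rH.
have cent k x y : (k <= n)%N ->
    lower_central [set: G] (n - k) x -> H x -> H y -> commute x y.
  elim: k => [|k IHk] in x y *.
    by move=> _; rewrite subn0 gn1 => -> _ _; apply/commute_sym/commute1.
  move=> ltkn gx Hx Hy.
  have Hz : H [~ x, y] by apply: subgroupR.
  have gz : lower_central [set: G] (n - k) [~ x, y].
    by rewrite -(subnSK ltkn) /lower_central iterS; apply: mem_commutator.
  apply/commgP/eqP; apply: (RFRS_central_commg H) => //;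
    by apply: commute_sym; apply: IHk (ltnW ltkn) gz Hz _.
by move=> x y; apply: (cent n) => //; rewrite subnn.
Qed.

End NilpotentRFRS.

Theorem theorem1p6 (N : groupType) :
  finitely_generated [set: N] -> Defs.nilpotent [set: N] ->
  virtually (@Defs.abelian N) [set: N] \/ ~ virtually (@RFRS N) [set: N].
Proof.
move=> _ nilN; have [vR|nvR] := pselect (virtually (@RFRS N) [set: N]).
  left; have [H [sH iH rH]] := vR.
  by exists H; split=> //; apply: nilpotent_RFRS_abelian.
by right.
Qed.
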